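(* Assume that the empirical optimization problem $Z_0=\min_{\bm x\in\mathcal X}\frac1\Omega\sum_{\omega\in[\Omega]}g(\bm x,\hat{\bm z}^\omega)$ is solvable, i.e. there exists $\hat{\bm x}\in\mathcal X$ with $Z_0=\frac1\Omega\sum_{\omega\in[\Omega]}g(\hat{\bm x},\hat{\bm z}^\omega)$. If the problem $$\min\Big\{k\ :\ \tfrac1\Omega\sum_{\omega\in[\Omega]}\upsilon_\omega\le\tau,\ (\bm x,\upsilon_\omega,k)\in\bar{\mathcal Y}^\omega\ \forall\omega\in[\Omega],\ \bm x\in\mathcal X,\ \bm\upsilon\in\mathbb R^\Omega,\ k\in\mathbb R_+\Big\}\qquad(\mathrm A)$$ is a tractable safe approximation of the problem $$\min\Big\{k\ :\ \tfrac1\Omega\sum_{\omega\in[\Omega]}\upsilon_\omega\le\tau,\ (\bm x,\upsilon_\omega,k)\in\mathcal Y^\omega\ \forall\omega\in[\Omega],\ \bm x\in\mathcal X,\ \bm\upsilon\in\mathbb R^\Omega,\ k\in\mathbb R_+\Big\},\qquad(\mathrm E)$$ then problem (A) is feasible for all $\tau>Z_0$.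
   Context: Notation: $[\Omega]=\{1,\dots,\Omega\}$. $\mathcal X\subseteq\mathbb R^{n_x}$ is the set of decisions, $\mathcal Z\subseteq\mathbb R^{n_z}$ is the support set, $g(\bm x,\bm z)$ is a real-valued evaluation function, and $\hat{\bm z}^1,\dots,\hat{\bm z}^\Omega\in\mathcal Z$ are data samples. Fix a norm $\|\cdot\|$ on $\mathbb R^{n_z}$ and $q\ge1$, and put $p(\bm z)=\|\bm z\|^q$. For $\omega\in[\Omega]$ let $\mathcal Z^\omega=\{\bm z\in\mathbb R^{n_z}:\bm z+\hat{\bm z}^\omega\in\mathcal Z\}$, $g^\omega(\bm x,\bm z)=g(\bm x,\bm z+\hat{\bm z}^\omega)$, and $$\mathcal Y^\omega=\Big\{(\bm x,\upsilon,k)\in\mathcal X\times\mathbb R\times\mathbb R_+ :\ \sup_{\bm z\in\mathcal Z^\omega}\{g^\omega(\bm x,\bm z)-k\,p(\bm z)\}\le\upsilon\Big\}.$$ Definition. Given sets $\bar{\mathcal Y}^\omega$, $\omega\in[\Omega]$, problem (A) is a tractable safe approximation of problem (E) if for all $\omega\in[\Omega]$: 1. $\bar{\mathcal Y}^\omega$ is a computationally tractable convex set; 2. $\bar{\mathcal Y}^\omega\subseteq\mathcal Y^\omega$; 3. the set $\{\bm x\in\mathcal X:(\bm x,\upsilon,k)\in\bar{\mathcal Y}^\omega\}$ is nondecreasing (with respect to inclusion) in $\upsilon$ and in $k$; 4. for any $\bm x\in\mathcal X$ and $\upsilon>g^\omega(\bm x,\bm 0)$ there exists a finite $\bar k\ge0$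 such that $(\bm x,\upsilon,\bar k)\in\bar{\mathcal Y}^\omega$. (''Computationally tractable'' in item 1 is an informal notion: describable by a modest number of auxiliary variables together with linear and conic constraints.) *)

(* Defs.v *)
From HB Require Import structures.
From mathcomp Require Import all_boot all_order all_algebra.
From mathcomp Require Import boolp classical_sets reals constructive_ereal ereal.
From mathcomp Require Import exp convex.

Set Implicit Arguments.
Unset Strict Implicit.
Unset Printing Implicit Defensive.

Import Order.TTheory GRing.Theory Num.Theory.
Local Open Scope classical_set_scope.
Local Open Scope ring_scope.

(* An arbitrary norm: the library's `|z| on 'rV[R]_n is only the sup norm. *)
Definition is_norm (R : realType) (V : lmodType R) (N : V -> R) : Prop :=
  [/\ forall z, N z = 0 -> z = 0,
      forall (a : R) z, N (a *: z) = `|a| * N z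
    & forall z1 z2, N (z1 + z2) <= N z1 + N z2].

Record min_problem (R : realType) (T : Type) := MinProblem {
  objective : T -> R;
  feasible_set : set T }.

Definition feasible (R : realType) (T : Type) (P : min_problem R T) : Prop :=
  feasible_set P !=set0.

Definition optimal_value (R : realType) (T : Type) (P : min_problem R T) :
  \bar R := ereal_inf [set (objective P t)%:E | t in feasible_set P].

Definition solvable (R : realType) (T : Type) (P : min_problem R T) : Prop :=
  exists2 t, feasible_set P t & optimal_value P = (objective P t)%:E.

Section RobustSatisficing.
Variables (R : realType) (nx nz Omega : nat).
Variables (X : set 'rV[R]_nx) (Z : set 'rV[R]_nz).
Variable (g : 'rV[R]_nx -> 'rV[R]_nz -> R).
Variable (zhat : 'I_Omega -> 'rV[R]_nz).

Definition empirical_problem : min_problem R 'rV[R]_nx :=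
  MinProblem (fun x => Omega%:R^-1 * \sum_(w < Omega) g x (zhat w)) X.

Definition shifted_support (w : 'I_Omega) : set 'rV[R]_nz :=
  [set z | Z (z + zhat w)].

Definition shifted_eval (w : 'I_Omega) (x : 'rV[R]_nx) (z : 'rV[R]_nz) : R :=
  g x (z + zhat w).

(* R^o rather than R, so that the triples (x, v, k) form an lmodType. *)
Definition triple : Type := ('rV[R]_nx * R^o * R^o)%type.

(* The supremum is taken in \bar R: it may be +oo. *)
Definition robust_set (p : 'rV[R]_nz -> R) (w : 'I_Omega) : set triple :=
  [set t | let: (x, v, k) := t in
    [/\ X x, 0 <= k
      & (ereal_sup [set (shifted_eval w x z - k * p z)%:E
                   | z in shifted_support w] <= v%:E)%E]].

Definition satisficing_variables : Type :=
  ('rV[R]_nx * 'rV[R]_Omega * R)%type.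

Definition satisficing_problem (Y : 'I_Omega -> set triple) (tau : R) :
    min_problem R satisficing_variables :=
  MinProblem (fun s : satisficing_variables => let: (_, _, k) := s in k)
    [set s : satisficing_variables | let: (x, v, k) := s in
      [/\ Omega%:R^-1 * \sum_(w < Omega) v ord0 w <= tau,
          forall w, Y w (x, v ord0 w, k),
          X x
        & 0 <= k]].

(* [tractable] stands for the informal notion of computational tractability;
   it is left abstract, and only convexity is made precise. *)
Definition tractable_safe_approximation (tractable : set triple -> Prop)
    (Ybar Y : 'I_Omega -> set triple) : Prop :=
  forall w : 'I_Omega,
  [/\ tractable (Ybar w)
        /\ convex_set (M := ('rV[R]_nx * R^o * R^o)%type) (Ybar w),
      Ybar w `<=` Y w,
      (forall k v1 v2 : R, 0 <= k -> v1 <= v2 ->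
         [set x | X x /\ Ybar w (x, v1, k)]
           `<=` [set x | X x /\ Ybar w (x, v2, k)])
        /\ (forall v k1 k2 : R, 0 <= k1 -> k1 <= k2 ->
         [set x | X x /\ Ybar w (x, v, k1)]
           `<=` [set x | X x /\ Ybar w (x, v, k2)])
    & forall (x : 'rV[R]_nx) (v : R), X x -> shifted_eval w x 0 < v ->
        exists2 kbar : R, 0 <= kbar & Ybar w (x, v, kbar)].

End RobustSatisficing.

(* Main.v *)
Require Import Defs.
From mathcomp Require Import all_boot all_order all_algebra.
From mathcomp Require Import boolp classical_sets reals constructive_ereal ereal.
From mathcomp Require Import exp convex.

Set Implicit Arguments.
Unset Strict Implicit.
Unset Printing Implicit Defensive.

Import Order.TTheory GRing.Theory Num.Theory.
Local Open Scope classical_set_scope.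
Local Open Scope ring_scope.

(** Let [x] be an empirical minimizer.  As the threshold [tau] exceeds the
    average of the values [g x (zhat w)], the slack [tau - Z_0] can be added to
    every one of them: the levels [v_w := g x (zhat w) + (tau - Z_0)] average to
    exactly [tau], and each lies strictly above the evaluation at its own
    sample.  The last condition on a safe approximation then gives a finite
    [k_w] for each sample.  The problem asks for a single [k] common to all
    samples; since there are finitely many of them and each approximating set
    is monotone in [k], a common upper bound of the [k_w] will do
    ([common_level]). *)

(** The sum serves as the common upper bound: its terms are nonnegative. *)
Lemma common_level (R : realDomainType) (I : finType) (P : I -> R -> Prop) :
  (forall i k1 k2, 0 <= k1 -> k1 <= k2 -> P i k1 -> P i k2) ->
  (forall i, exists2 k, 0 <= k & P i k) ->
  exists2 k, 0 <= k & forall i, P i k.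
Proof.
move=> Pmono Pex.
have /choice[k kP] : forall i, exists k, 0 <= k /\ P i k.
  by move=> i; have [k k0 Pk] := Pex i; exists k.
have k_ge0 i : 0 <= k i by case: (kP i).
exists (\sum_i k i) => [|i]; first exact: sumr_ge0.
apply: (Pmono i (k i)) => //; last by case: (kP i).
by rewrite (bigD1 i) //= lerDl sumr_ge0.
Qed.

Lemma mean_addr (R : numFieldType) (n : nat) (a : 'I_n -> R) (d : R) :
  (0 < n)%N ->
  n%:R^-1 * \sum_(i < n) (a i + d) = n%:R^-1 * \sum_(i < n) a i + d.
Proof.
move=> n_gt0; rewrite big_split /= sumr_const card_ord mulrDr -(mulr_natl d).
by rewrite mulKf // pnatr_eq0 -lt0n.
Qed.

Theorem proposition2 (R : realType) (nx nz Omega : nat) (hOmega : (0 < Omega)%N)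
  (X : set 'rV[R]_nx) (Z : set 'rV[R]_nz)
  (g : 'rV[R]_nx -> 'rV[R]_nz -> R)
  (zhat : 'I_Omega -> 'rV[R]_nz) (hzhat : forall w, Z (zhat w))
  (N : 'rV[R]_nz -> R) (hN : is_norm N) (q : R) (hq : 1 <= q)
  (tractable : set (triple R nx) -> Prop)
  (Ybar : 'I_Omega -> set (triple R nx))
  (hsolv : solvable (empirical_problem X g zhat))
  (happrox : tractable_safe_approximation X g zhat tractable Ybar
               (robust_set X Z g zhat (fun z => N z `^ q))) :
  forall tau : R, (optimal_value (empirical_problem X g zhat) < tau%:E)%E ->
    feasible (satisficing_problem X Ybar tau).
Proof.
move=> tau; have [x Xx ->] := hsolv; rewrite lte_fin /= -subr_gt0.
set Z0 := Omega%:R^-1 * _ => slack_gt0.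
pose v : 'rV[R]_Omega := \row_w (g x (zhat w) + (tau - Z0)).
have [k k0 Yk] : exists2 k : R, 0 <= k & forall w, Ybar w (x, v ord0 w, k).
  apply: common_level => w; have [_ _ [_ kmono] kbar] := happrox w.
    by move=> k1 k2 k1_ge0 k12 Yk1; have [] := kmono _ _ _ k1_ge0 k12 x (conj Xx Yk1).
  by apply: kbar => //; rewrite /shifted_eval add0r mxE ltrDl.
exists (x, v, k); split => //.
under eq_bigr do rewrite mxE.
by rewrite mean_addr // subrKC.
Qed.
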